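(* Let $\mathbf{A}\in\mathbb{R}^{d\times d}$ be symmetric with smallest eigenvalue $\lambda_{\min}$ and largest eigenvalue $\lambda_{\max}$, let $\mathbf{b}\in\mathbb{R}^d$, and let $r(x)=n(x)/m(x)$, where $n$ is a real polynomial of degree $p$ and $m(x)=(x-z_1)(x-z_2)\cdots(x-z_q)$ with $q\ge 1$ and $z_1,\dots,z_q\in\mathbb{R}\setminus[\lambda_{\min},\lambda_{\max}]$. For $j=1,\dots,q$ define $$\mathbf{A}_j:=\begin{cases}+(\mathbf{A}-z_j\mathbf{I}) & \text{if } z_j<\lambda_{\min},\\ -(\mathbf{A}-z_j\mathbf{I}) & \text{if } z_j>\lambda_{\max}.\end{cases}$$ If $k>\max\{p,q-1\}$, then the Lanczos-FA iterate satisfies $$\|r(\mathbf{A})\mathbf{b}-\mathsf{lan}_k(r;\mathbf{A},\mathbf{b})\|_2\le q\cdot\kappa(\mathbf{A}_1)\cdot\kappa(\mathbf{A}_2)\cdots\kappa(\mathbf{A}_q)\min_{\deg(s)<k-q+1}\|r(\mathbf{A})\mathbf{b}-s(\mathbf{A})\mathbf{b}\|_2,$$ where the minimum is over real polynomials $s$ of degree less than $k-q+1$.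
   Context: For a symmetric matrix $\mathbf{M}=\sum_i\mu_i\mathbf{u}_i\mathbf{u}_i^{\mathsf T}$ (orthonormal eigendecomposition) and a scalar function $f$ defined on its eigenvalues, $f(\mathbf{M}):=\sum_i f(\mu_i)\mathbf{u}_i\mathbf{u}_i^{\mathsf T}$. The Krylov subspace is $\mathcal{K}_k(\mathbf{A},\mathbf{b})=\operatorname{span}\{\mathbf{b},\mathbf{A}\mathbf{b},\dots,\mathbf{A}^{k-1}\mathbf{b}\}$. Let $\mathbf{Q}$ be the matrix whose columns are the orthonormal basis of $\mathcal{K}_k(\mathbf{A},\mathbf{b})$ produced by the Lanczos algorithm in exact arithmetic (Gram–Schmidt applied to $\mathbf{b},\mathbf{A}\mathbf{b},\dots$; it has $\dim\mathcal{K}_k(\mathbf{A},\mathbf{b})$ columns), and let $\mathbf{T}=\mathbf{Q}^{\mathsf T}\mathbf{A}\mathbf{Q}$, which is symmetric tridiagonal. The Lanczos-FA iterate is $\mathsf{lan}_k(f;\mathbf{A},\mathbf{b}):=\mathbf{Q}f(\mathbf{T})\mathbf{Q}^{\mathsf T}\mathbf{b}$. $\kappa(\mathbf{M})$ is the condition number: the ratio of the largest to the smallest magnitude of the eigenvalues of $\mathbf{M}$. *)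

(* Defs.v *)
From mathcomp Require Import all_boot all_order all_algebra.
From mathcomp Require Import boolp classical_sets reals.

Set Implicit Arguments.
Unset Strict Implicit.
Unset Printing Implicit Defensive.

Import Order.TTheory GRing.Theory Num.Theory.

Local Open Scope classical_set_scope.
Local Open Scope ring_scope.

Definition is_minimum (R : realType) (S : set R) (x : R) : Prop :=
  S x /\ lbound S x.

Definition is_maximum (R : realType) (S : set R) (x : R) : Prop :=
  S x /\ ubound S x.

Definition dotcv (R : realType) (d : nat) (u v : 'cV[R]_d) : R :=
  (u^T *m v) 0 0.

(* The library norm on matrices is the sup norm, hence this definition. *)
Definition norm2 (R : realType) (d : nat) (v : 'cV[R]_d) : R :=
  Num.sqrt (dotcv v v).

Definition spectrum (R : realType) (d : nat) (M : 'M[R]_d) : set R :=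
  [set a | eigenvalue M a].

(* The spectrum is finite, so the supremum and the infimum are attained as soon
   as it is nonempty. *)
Definition cond (R : realType) (d : nat) (M : 'M[R]_d) : R :=
  sup [set `|a| | a in spectrum M] / inf [set `|a| | a in spectrum M].

(* The columns of U are orthonormal eigenvectors of M, with eigenvalues mu. *)
Definition is_matfun (R : realType) (d : nat) (f : R -> R) (M F : 'M[R]_d) :
    Prop :=
  exists (U : 'M[R]_d) (mu : 'rV[R]_d),
    [/\ U^T *m U = 1%:M,
        M = U *m diag_mx mu *m U^T
      & F = U *m diag_mx (map_mx f mu) *m U^T].

(* Meaningful for symmetric M: F then exists by the spectral theorem and does
   not depend on the chosen eigendecomposition. *)
Definition matfun (R : realType) (d : nat) (f : R -> R) (M : 'M[R]_d) :
    'M[R]_d :=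
  xget 0 [set F | is_matfun f M F].

Definition gram_schmidt_step (R : realType) (d : nat)
    (qs : seq 'cV[R]_d) (v : 'cV[R]_d) : seq 'cV[R]_d :=
  let w := v - \sum_(q <- qs) dotcv q v *: q in
  if w == 0 then qs else rcons qs ((norm2 w)^-1 *: w).

Definition gram_schmidt (R : realType) (d : nat) (vs : seq 'cV[R]_d) :
    seq 'cV[R]_d :=
  foldl (@gram_schmidt_step R d) [::] vs.

Definition krylov_seq (R : realType) (d k : nat) (A : 'M[R]_d) (b : 'cV[R]_d) :
    seq 'cV[R]_d :=
  [seq iter i (mulmx A) b | i <- iota 0 k].

Definition lanczos_basis (R : realType) (d k : nat) (A : 'M[R]_d)
    (b : 'cV[R]_d) : seq 'cV[R]_d :=
  gram_schmidt (krylov_seq k A b).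

(* The number of columns is the dimension of the Krylov space, which may be
   less than k (and is 0 when b = 0). *)
Definition lanczos_Q (R : realType) (d k : nat) (A : 'M[R]_d) (b : 'cV[R]_d) :
    'M[R]_(d, size (lanczos_basis k A b)) :=
  \matrix_(i, j) (lanczos_basis k A b)`_j i 0.

Definition lanczos_T (R : realType) (d k : nat) (A : 'M[R]_d) (b : 'cV[R]_d) :
    'M[R]_(size (lanczos_basis k A b)) :=
  (lanczos_Q k A b)^T *m A *m lanczos_Q k A b.

Definition lan (R : realType) (d k : nat) (f : R -> R) (A : 'M[R]_d)
    (b : 'cV[R]_d) : 'cV[R]_d :=
  lanczos_Q k A b *m matfun f (lanczos_T k A b) *m (lanczos_Q k A b)^T *m b.

Definition ratfun (R : realType) (q : nat) (n : {poly R}) (z : 'I_q -> R)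
    (x : R) : R :=
  n.[x] / \prod_(j < q) (x - z j).

(* For z outside [lmin, lmax], the second branch is the case lmax < z. *)
Definition shifted (R : realType) (d : nat) (A : 'M[R]_d) (lmin z : R) :
    'M[R]_d :=
  if z < lmin then A - z%:M else - (A - z%:M).

(* Main.v *)
Require Import Defs.
From mathcomp Require Import all_boot all_order all_algebra.
From mathcomp Require Import boolp classical_sets reals.
From mathcomp Require Import zify ring lra complex.

Import Order.TTheory GRing.Theory Num.Theory.
Local Open Scope classical_set_scope.
Local Open Scope ring_scope.

Set Implicit Arguments.
Unset Strict Implicit.
Unset Printing Implicit Defensive.

(** Write [x := r(A) b], [M_j := A - z_j I], [T_j := Q^T M_j Q] and
    [Y_j := Q T_j^-1 Q^T]. Since [n] has degree below [k], the compression [T]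
    acts on [Q^T b] through [n] as [A] acts on [b], so [n(T) Q^T b = Q^T n(A) b]
    (lemma [lanczos_T_horner]) and the Lanczos iterate is
    [Y_1 .. Y_q M_q .. M_1 x]. The error therefore telescopes:
    [x - Y_1 .. Y_q M_q .. M_1 x =
       (x - Y_1 M_1 x) + Y_1 (M_1 x - Y_2 .. Y_q M_q .. M_2 (M_1 x))],
    where the last parenthesis has the same form with one shift less
    (lemma [lanczos_product_error]).

    Each summand is controlled by the theory of one linear system. Up to a sign,
    [M_j] is positive definite with eigenvalues between two positive numbers
    [lo] and [hi] whose ratio is the condition number of [A_j]
    (lemma [cond_shifted]). The operator [1 - Y_j M_j] is the projection along
    the Krylov space that is orthogonal for the inner product of [M_j]; hence it
    annihilates every Krylov vector, and its Euclidean norm is at most [hi / lo]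
    (lemma [galerkin_error]). Moreover [M_j] has norm at most [hi], and [Y_j]
    has norm at most [1 / lo] because compression keeps eigenvalues inside
    [[lmin, lmax]] (lemma [spectrum_compression]). So [s(A) b] may be subtracted
    from [x], provided that [s] multiplied by all but one of the factors of the
    denominator still has degree below [k]; this is the degree bound on [s]. The
    [q] summands are each at most the product of the condition numbers times
    [norm2 (x - s(A) b)].

    The functional calculus behind these manipulations comes from the real
    spectral theorem (lemma [real_spectral]) and from the independence of
    [matfun] from the chosen decomposition (lemma [matfun_unique]). The minimum
    over [s] is attained because it is the distance to a Krylov space, onto
    which the Gram--Schmidt basis gives the orthogonal projection
    (lemma [krylov_best_approx]). *)

(** * Dot product and Euclidean norm *)

Lemma dotcvE (R : realType) d (u v : 'cV[R]_d) :
  dotcv u v = \sum_i u i 0 * v i 0.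
Proof. by rewrite /dotcv mxE; apply: eq_bigr => i _; rewrite mxE. Qed.

Lemma dotcvC (R : realType) d (u v : 'cV[R]_d) : dotcv u v = dotcv v u.
Proof. by rewrite !dotcvE; apply: eq_bigr => i _; rewrite mulrC. Qed.

Lemma dotcvDr (R : realType) d (u v w : 'cV[R]_d) :
  dotcv u (v + w) = dotcv u v + dotcv u w.
Proof. by rewrite /dotcv mulmxDr mxE. Qed.

Lemma dotcvDl (R : realType) d (u v w : 'cV[R]_d) :
  dotcv (v + w) u = dotcv v u + dotcv w u.
Proof. by rewrite dotcvC dotcvDr !(dotcvC u). Qed.

Lemma dotcvZr (R : realType) d a (u v : 'cV[R]_d) :
  dotcv u (a *: v) = a * dotcv u v.
Proof. by rewrite /dotcv -scalemxAr mxE. Qed.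

Lemma dotcvZl (R : realType) d a (u v : 'cV[R]_d) :
  dotcv (a *: u) v = a * dotcv u v.
Proof. by rewrite dotcvC dotcvZr dotcvC. Qed.

Lemma dotcvNr (R : realType) d (u v : 'cV[R]_d) : dotcv u (- v) = - dotcv u v.
Proof. by rewrite -scaleN1r dotcvZr mulN1r. Qed.

Lemma dotcvNl (R : realType) d (u v : 'cV[R]_d) : dotcv (- u) v = - dotcv u v.
Proof. by rewrite dotcvC dotcvNr dotcvC. Qed.

Lemma dotcv0 (R : realType) d (u : 'cV[R]_d) : dotcv u 0 = 0.
Proof. by rewrite /dotcv mulmx0 mxE. Qed.

Lemma dotcv_sumr (R : realType) d (I : Type) (r : seq I) (P : pred I)
    (u : 'cV[R]_d) (F : I -> 'cV[R]_d) :
  dotcv u (\sum_(i <- r | P i) F i) = \sum_(i <- r | P i) dotcv u (F i).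
Proof. exact: (big_morph (dotcv u) (dotcvDr u) (dotcv0 u)). Qed.

Lemma dotcv_mulmxl (R : realType) d e (M : 'M[R]_(d, e)) u v :
  dotcv (M *m u) v = dotcv u (M^T *m v).
Proof. by rewrite /dotcv trmx_mul mulmxA. Qed.

Lemma dotcv_ge0 (R : realType) d (v : 'cV[R]_d) : 0 <= dotcv v v.
Proof. by rewrite dotcvE sumr_ge0 // => i _; rewrite -expr2 sqr_ge0. Qed.

Lemma dotcv_eq0 (R : realType) d (v : 'cV[R]_d) : (dotcv v v == 0) = (v == 0).
Proof.
apply/eqP/eqP => [|->]; last by rewrite dotcv0.
rewrite dotcvE => /psumr_eq0P v0; apply/matrixP => i j; rewrite (ord1 j) mxE.
apply/eqP; rewrite -sqrf_eq0 expr2 v0 // => l _.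
by rewrite -expr2 sqr_ge0.
Qed.

Lemma norm2_ge0 (R : realType) d (v : 'cV[R]_d) : 0 <= norm2 v.
Proof. exact: sqrtr_ge0. Qed.

Lemma norm2_sqr (R : realType) d (v : 'cV[R]_d) : norm2 v ^+ 2 = dotcv v v.
Proof. by rewrite sqr_sqrtr // dotcv_ge0. Qed.

Lemma norm2_eq0 (R : realType) d (v : 'cV[R]_d) : (norm2 v == 0) = (v == 0).
Proof. by rewrite -sqrf_eq0 norm2_sqr dotcv_eq0. Qed.

Lemma norm2_le_sqr (R : realType) d e c (u : 'cV[R]_d) (v : 'cV[R]_e) :
  0 <= c -> dotcv u u <= c ^+ 2 * dotcv v v -> norm2 u <= c * norm2 v.
Proof.
move=> c0; rewrite -!norm2_sqr -exprMn ler_sqr // nnegrE.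
  exact: norm2_ge0.
by rewrite mulr_ge0 // norm2_ge0.
Qed.

(** Cauchy--Schwarz, read off [0 <= |norm2 v *: u - norm2 u *: v|^2]. *)
Lemma dotcv_le_norm2 (R : realType) d (u v : 'cV[R]_d) :
  dotcv u v <= norm2 u * norm2 v.
Proof.
have [->|u0] := eqVneq u 0; first by rewrite dotcvC dotcv0 mulr_ge0 ?norm2_ge0.
have [->|v0] := eqVneq v 0; first by rewrite dotcv0 mulr_ge0 ?norm2_ge0.
have ugt : 0 < norm2 u by rewrite lt_def norm2_eq0 u0 norm2_ge0.
have vgt : 0 < norm2 v by rewrite lt_def norm2_eq0 v0 norm2_ge0.
have := dotcv_ge0 (norm2 v *: u - norm2 u *: v).
rewrite dotcvDr !dotcvDl !dotcvNr !dotcvNl !dotcvZr !dotcvZl -!norm2_sqr.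
rewrite (dotcvC v u) => h.
rewrite -subr_ge0 -(@pmulr_rge0 _ (norm2 u * norm2 v *+ 2)).
  by apply: le_trans h _; rewrite le_eqVlt; apply/orP; left; apply/eqP; ring.
by rewrite pmulrn_lgt0 // mulr_gt0.
Qed.

Lemma norm2D (R : realType) d (u v : 'cV[R]_d) :
  norm2 (u + v) <= norm2 u + norm2 v.
Proof.
rewrite -ler_sqr ?nnegrE ?addr_ge0 ?norm2_ge0 //.
rewrite norm2_sqr sqrrD dotcvDr !dotcvDl (dotcvC v u) !norm2_sqr.
have := dotcv_le_norm2 u v; lra.
Qed.

Lemma norm2_isometry (R : realType) d e (Q : 'M[R]_(d, e)) v :
  Q^T *m Q = 1%:M -> norm2 (Q *m v) = norm2 v.
Proof. by move=> QQ; rewrite /norm2 dotcv_mulmxl mulmxA QQ mul1mx. Qed.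

(** Pythagoras: the residual [v - Q *m (Q^T *m v)] is orthogonal to the column
    space of [Q]. *)
Lemma norm2_proj_le (R : realType) d e (Q : 'M[R]_(d, e)) v y :
  Q^T *m Q = 1%:M -> norm2 (v - Q *m (Q^T *m v)) <= norm2 (v - Q *m y).
Proof.
move=> QQ; rewrite -[leRHS]mul1r; apply: norm2_le_sqr => //.
rewrite expr1n mul1r; set w := v - Q *m (Q^T *m v).
have -> : v - Q *m y = w + Q *m (Q^T *m v - y).
  by rewrite mulmxBr addrA subrK.
set u := Q *m _; have Qw : dotcv w u = 0.
  rewrite dotcvC dotcv_mulmxl mulmxBr (mulmxA Q^T) QQ mul1mx subrr.
  by rewrite dotcv0.
move: w u Qw => w u Qw.
rewrite dotcvDr !dotcvDl [dotcv u w]dotcvC Qw addr0 add0r.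
by rewrite lerDl dotcv_ge0.
Qed.

Lemma bessel_inequality (R : realType) d e (Q : 'M[R]_(d, e)) v :
  Q^T *m Q = 1%:M -> norm2 (Q^T *m v) <= norm2 v.
Proof.
move=> QQ; rewrite -[leRHS]mul1r; apply: norm2_le_sqr => //.
rewrite expr1n mul1r; set y := Q^T *m v.
have vQy : dotcv v (Q *m y) = dotcv y y by rewrite dotcvC dotcv_mulmxl.
have QyQy : dotcv (Q *m y) (Q *m y) = dotcv y y.
  by rewrite -!norm2_sqr norm2_isometry.
have := dotcv_ge0 (v - Q *m y).
rewrite dotcvDr !dotcvDl !dotcvNr !dotcvNl QyQy (dotcvC (Q *m y)) vQy.
lra.
Qed.

(** * Diagonalization of real symmetric matrices *)

(** Over the complex extension the matrix is Hermitian, hence unitarily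
    diagonalizable with a real diagonal; a real root of the characteristic
    polynomial is an eigenvalue over the real field already. *)
Lemma symmetric_eigenvalue (R : realType) n (A : 'M[R]_n.+1) :
  A^T = A -> exists a, eigenvalue A a.
Proof.
move=> As; pose toC := real_complex R; pose C := map_mx toC A.
have Cs : C \is hermsymmx.
  apply: realsym_hermsym.
    apply/is_hermitianmxP.
    by rewrite expr0 scale1r map_mx_id // /C map_trmx As.
  by apply/mxOverP => i j; rewrite mxE complex_real.
have /orthomx_spectralP Cdec := hermitian_normalmx Cs.
have /mxOverP sreal := hermitian_spectral_diag_real Cs.
pose s := spectral_diag C 0 0.
have Cs' : eigenvalue C s.
  apply/eigenvalueP; exists (row 0 (spectralmx C)).
    rewrite [X in _ *m X]Cdec -row_mul !mulmxA mulmxV ?spectral_unit //.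
    by rewrite mul1mx row_mul row_diag_mx -scalemxAl -rowE.
  apply/eqP => /(congr1 (mulmx^~ (invmx (spectralmx C)))).
  rewrite -row_mul mulmxV ?spectral_unit // mul0mx => /rowP /(_ 0).
  by rewrite !mxE => /eqP; rewrite oner_eq0.
exists (complex.Re s); rewrite -(@eigenvalue_map _ _ toC) /=.
by rewrite /toC /= RRe_real // sreal.
Qed.

(** The reflection in the hyperplane orthogonal to [u - e_0] exchanges the unit
    vectors [u] and [e_0]; this completes [u] to an orthonormal basis. *)
Lemma householder (R : realType) n (u : 'cV[R]_n.+1) :
  dotcv u u = 1 ->
  exists H : 'M[R]_n.+1,
    [/\ H^T = H, H *m H = 1%:M & H *m delta_mx 0 0 = u].
Proof.
move=> uu; pose e0 : 'cV[R]_n.+1 := delta_mx 0 0; pose w := u - e0.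
have [u0|u0] := eqVneq u e0.
  by exists 1%:M; split; rewrite ?trmx1 ?mul1mx ?u0.
have ww0 : dotcv w w != 0 by rewrite dotcv_eq0 subr_eq0.
have ee : dotcv e0 e0 = 1 by rewrite /dotcv trmx_delta mul_delta_mx mxE !eqxx.
have we : dotcv w w = - 2 * dotcv w e0.
  rewrite /w !dotcvDr !dotcvDl !dotcvNr !dotcvNl uu ee (dotcvC e0 u); ring.
have uw : u = e0 + w by rewrite /w addrC subrK.
move: w ww0 we uw => w ww0 we uw.
have wTw x : w^T *m x = (dotcv w x)%:M by rewrite [LHS]mx11_scalar.
pose c := 2 / dotcv w w.
exists (1%:M - c *: (w *m w^T)); split.
- by rewrite linearB /= linearZ /= trmx1 trmx_mul trmxK.
- rewrite mulmxBr mulmx1 mulmxBl mul1mx -scalemxAl -scalemxAr.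
  rewrite mulmxA -(mulmxA w) wTw mul_mx_scalar -scalemxAl !scalerA.
  have -> : c * (c * dotcv w w) = c + c by rewrite /c; field.
  rewrite scalerDl; set X := c *: _.
  by rewrite opprB addrK subrK.
- rewrite mulmxBl mul1mx -scalemxAl -mulmxA wTw mul_mx_scalar scalerA.
  have -> : c * dotcv w e0 = -1.
    rewrite /c we; have : dotcv w e0 != 0.
      by apply: contraNneq ww0 => we0; rewrite we we0 mulr0.
    by move=> ?; field.
  by rewrite scaleN1r opprK.
Qed.

(** Induction on the dimension: a unit eigenvector is moved to the first
    coordinate axis by a reflection, and the complementary diagonal block is
    again symmetric. *)
Lemma real_spectral (R : realType) n (A : 'M[R]_n) :
  A^T = A ->
  exists (U : 'M[R]_n) (mu : 'rV[R]_n),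
    U^T *m U = 1%:M /\ A = U *m diag_mx mu *m U^T.
Proof.
elim: n A => [|n IH] A As.
  by exists 1%:M, 0; split; [rewrite trmx1 mulmx1 | rewrite !flatmx0].
have [a /eigenvalueP [v vA v0]] := symmetric_eigenvalue As.
pose w := v^T; have w0 : w != 0.
  by apply: contra v0 => /eqP w0; rewrite -(trmxK v) -/w w0 trmx0.
have Aw : A *m w = a *: w by rewrite /w -{1}As -trmx_mul vA linearZ.
pose u := (norm2 w)^-1 *: w.
have uu : dotcv u u = 1.
  rewrite /u dotcvZr dotcvZl -norm2_sqr.
  by field; rewrite norm2_eq0.
have Au : A *m u = a *: u by rewrite /u -scalemxAr Aw !scalerA mulrC.
have [H [HT HH He]] := householder uu.
have Hu : H *m u = delta_mx 0 0 by rewrite -He mulmxA HH mul1mx.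
pose B : 'M[R]_(1 + n) := H *m A *m H.
have BT : B^T = B by rewrite /B !trmx_mul HT As mulmxA.
have Be : B *m delta_mx 0 0 = a *: delta_mx 0 0 :> 'cV[R]_(1 + n).
  by rewrite /B -!mulmxA He Au -scalemxAr Hu.
have AB : A = H *m B *m H.
  by rewrite /B !mulmxA HH mul1mx -mulmxA HH mulmx1.
move: B BT Be AB => B BT Be AB.
have Bcol (i : 'I_(1 + n)) (j : 'I_1) :
    B i (lshift n j) = a * (i == lshift n j)%:R.
  have -> : lshift n j = 0 by apply: val_inj; rewrite ord1.
  by have /matrixP/(_ i 0) := Be; rewrite -colE !mxE eqxx andbT.
have Bblock : B = block_mx a%:M 0 0 (drsubmx B).
  rewrite -[LHS]submxK; congr block_mx; apply/matrixP => i j.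
  - by rewrite !mxE Bcol eq_lshift !ord1 eqxx mulr1.
  - by rewrite -BT !mxE Bcol eq_rlshift mulr0.
  - by rewrite !mxE Bcol eq_rlshift mulr0.
have [|V [mu [VV Vmu]]] := IH (drsubmx B).
  by rewrite trmx_drsub BT.
pose W : 'M[R]_(1 + n) := block_mx 1%:M 0 0 V.
have WT : W^T = block_mx 1%:M 0 0 V^T.
  by rewrite /W tr_block_mx !trmx0 trmx1.
have WW : W^T *m W = 1%:M.
  rewrite WT /W mulmx_block !mulmx0 !mul0mx !addr0 !add0r mulmx1 VV.
  by rewrite -scalar_mx_block.
pose nu : 'rV[R]_(1 + n) := row_mx a%:M mu.
have Bdec : B = W *m diag_mx nu *m W^T.
  rewrite Bblock diag_mx_row WT /W !mulmx_block.
  rewrite !mulmx0 !mul0mx !addr0 !add0r !mul0mx !mul1mx !mulmx1 -Vmu.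
  by congr block_mx; apply/matrixP => i j; rewrite !ord1 !mxE !eqxx.
exists (H *m W), nu; split.
  by rewrite trmx_mul HT mulmxA -(mulmxA W^T) HH mulmx1.
by rewrite AB Bdec trmx_mul HT !mulmxA.
Qed.

(** * Functions of a symmetric matrix *)

(** With [W := V^T *m U], equality of the two decompositions says
    [mu' i * W i j = W i j * mu j]; hence [mu' i = mu j] wherever [W i j] is
    nonzero, and the same relation holds with [f] applied to both. *)
Lemma matfun_unique (R : realType) n (f : R -> R) (U V : 'M[R]_n) mu mu' :
  U^T *m U = 1%:M -> V^T *m V = 1%:M ->
  U *m diag_mx mu *m U^T = V *m diag_mx mu' *m V^T ->
  U *m diag_mx (map_mx f mu) *m U^T = V *m diag_mx (map_mx f mu') *m V^T.
Proof.
move=> UU VV UV; pose W := V^T *m U.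
have UU' := mulmx1C UU; have VV' := mulmx1C VV.
have Wcomm : W *m diag_mx mu = diag_mx mu' *m W.
  have /(congr1 (fun M => V^T *m M *m U)) := UV.
  rewrite !mulmxA VV mul1mx -(mulmxA _ V^T) => <-.
  by rewrite -[RHS]mulmxA UU mulmx1.
have Wcommf : W *m diag_mx (map_mx f mu) = diag_mx (map_mx f mu') *m W.
  move: W Wcomm => W Wcomm; apply/matrixP => i j.
  move/matrixP/(_ i j): Wcomm.
  rewrite !mul_mx_diag !mul_diag_mx !mxE => Wij.
  have [->|W0] := eqVneq (W i j) 0; first by rewrite mul0r mulr0.
  suff -> : mu 0 j = mu' 0 i by rewrite mulrC.
  by apply: (mulfI W0); rewrite Wij mulrC.
have /(congr1 (fun M => V *m M *m U^T)) := Wcommf.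
rewrite /W !mulmxA VV' mul1mx => ->.
by rewrite -!mulmxA UU' mulmx1.
Qed.

Lemma matfunE (R : realType) n (f : R -> R) (M U : 'M[R]_n) mu :
  U^T *m U = 1%:M -> M = U *m diag_mx mu *m U^T ->
  matfun f M = U *m diag_mx (map_mx f mu) *m U^T.
Proof.
move=> UU Mdec; apply: xget_unique; first by exists U, mu.
move=> F [V [nu [VV Mdec' ->]]]; apply: matfun_unique => //.
by rewrite -Mdec -Mdec'.
Qed.

Lemma spectral_eigenvalue (R : realType) n (M U : 'M[R]_n) mu i :
  U^T *m U = 1%:M -> M = U *m diag_mx mu *m U^T -> spectrum M (mu 0 i).
Proof.
move=> UU ->; apply/eigenvalueP; exists (row i U^T).
  by rewrite -row_mul !mulmxA UU mul1mx row_mul row_diag_mx -scalemxAl -rowE.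
apply/eqP => /(congr1 (mulmx^~ U)).
rewrite -row_mul UU mul0mx => /rowP /(_ i).
by rewrite !mxE eqxx => /eqP; rewrite oner_eq0.
Qed.

Lemma matfunM (R : realType) n (f g : R -> R) (M : 'M[R]_n) : M^T = M ->
  matfun (fun x => f x * g x) M = matfun f M *m matfun g M.
Proof.
move=> /real_spectral [U [mu [UU Mdec]]]; rewrite !(matfunE _ UU Mdec).
rewrite (_ : map_mx _ mu = \row_j (map_mx f mu 0 j * map_mx g mu 0 j)).
  by rewrite -mulmx_diag !mulmxA -(mulmxA _ U^T U) UU mulmx1.
by apply/rowP => i; rewrite !mxE.
Qed.

Lemma eq_matfun (R : realType) n (f g : R -> R) (M : 'M[R]_n) : M^T = M ->
  (forall a, spectrum M a -> f a = g a) -> matfun f M = matfun g M.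
Proof.
move=> /real_spectral [U [mu [UU Mdec]]] fg; rewrite !(matfunE _ UU Mdec).
congr (_ *m diag_mx _ *m _); apply/rowP => i; rewrite !mxE fg //.
exact: spectral_eigenvalue UU Mdec.
Qed.

Lemma matfun_id (R : realType) n (M : 'M[R]_n) : M^T = M -> matfun id M = M.
Proof.
move=> /real_spectral [U [mu [UU Mdec]]]; rewrite !(matfunE _ UU Mdec).
by rewrite map_mx_id.
Qed.

Lemma matfun_cst (R : realType) n a (M : 'M[R]_n) : M^T = M ->
  matfun (fun=> a) M = a%:M.
Proof.
move=> /real_spectral [U [mu [UU Mdec]]]; rewrite !(matfunE _ UU Mdec).
have -> : map_mx (fun=> a) mu = const_mx a by apply/rowP => i; rewrite !mxE.
by rewrite diag_const_mx mul_mx_scalar -scalemxAl mulmx1C // scalemx1.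
Qed.

Lemma matfunD (R : realType) n (f g : R -> R) (M : 'M[R]_n) : M^T = M ->
  matfun (fun x => f x + g x) M = matfun f M + matfun g M.
Proof.
move=> /real_spectral [U [mu [UU Mdec]]]; rewrite !(matfunE _ UU Mdec).
rewrite -mulmxDl -mulmxDr -linearD /=.
by congr (_ *m diag_mx _ *m _); apply/rowP => i; rewrite !mxE.
Qed.

Lemma matfun_shift (R : realType) n z (M : 'M[R]_n) : M^T = M ->
  matfun (fun x => x - z) M = M - z%:M.
Proof.
by move=> Ms; rewrite matfunD // matfun_id // matfun_cst // raddfN.
Qed.

(** Links the functional calculus with the Krylov vectors [A^i b], which are
    given as iterates. *)
Lemma matfun_horner (R : realType) n (s : {poly R}) (M : 'M[R]_n)
    (b : 'cV[R]_n) : M^T = M ->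
  matfun (fun x => s.[x]) M *m b =
  \sum_(i < size s) s`_i *: iter i (mulmx M) b.
Proof.
move=> Ms; rewrite (_ : (fun x => s.[x]) =
    (fun x => \sum_(i < size s) s`_i * x ^+ i)); last first.
  by apply: funext => x; rewrite horner_coef.
have Mpow i : matfun (fun x => x ^+ i) M *m b = iter i (mulmx M) b.
  elim: i => [|i IH]; first by rewrite matfun_cst // mul1mx.
  rewrite iterS -IH mulmxA; congr (_ *m _).
  transitivity (matfun id M *m matfun (fun x => x ^+ i) M).
    by rewrite -matfunM //; apply: eq_matfun => // x _; rewrite exprS.
  by rewrite matfun_id.
elim: (size s) => [|m IH].
  rewrite big_ord0 (_ : (fun x => _) = fun=> 0) ?matfun_cst ?raddf0 ?mul0mx //.
  by apply: funext => x; rewrite big_ord0.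
rewrite big_ord_recr /= -IH -Mpow scalemxAl -mulmxDl; congr (_ *m _).
rewrite -mul_scalar_mx -(matfun_cst s`_m Ms) -matfunM // -matfunD //.
by apply: eq_matfun => // x _; rewrite big_ord_recr.
Qed.

Lemma norm2_matfun_le (R : realType) n (f : R -> R) (M : 'M[R]_n) c v :
  M^T = M -> 0 <= c -> (forall a, spectrum M a -> `|f a| <= c) ->
  norm2 (matfun f M *m v) <= c * norm2 v.
Proof.
move=> /real_spectral [U [mu [UU Mdec]]] c0 fc; rewrite !(matfunE _ UU Mdec).
have UTU' : U^T^T *m U^T = 1%:M by rewrite trmxK mulmx1C.
rewrite -!mulmxA norm2_isometry // -[norm2 v](norm2_isometry _ UTU').
apply: norm2_le_sqr => //; rewrite !dotcvE mulr_sumr; apply: ler_sum => i _.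
rewrite mul_diag_mx !mxE -!expr2 exprMn ler_wpM2r ?sqr_ge0 //.
rewrite -real_normK ?num_real // ler_sqr ?nnegrE ?normr_ge0 //.
exact/fc/(spectral_eigenvalue _ UU Mdec).
Qed.

Lemma dotcv_matfun_ge (R : realType) n (f : R -> R) (M : 'M[R]_n) c v :
  M^T = M -> (forall a, spectrum M a -> c <= f a) ->
  c * dotcv v v <= dotcv v (matfun f M *m v).
Proof.
move=> /real_spectral [U [mu [UU Mdec]]] fc; rewrite !(matfunE _ UU Mdec).
have UTU' : U^T^T *m U^T = 1%:M by rewrite trmxK mulmx1C.
rewrite -!mulmxA dotcvC dotcv_mulmxl -norm2_sqr -(norm2_isometry _ UTU').
rewrite norm2_sqr; set x := U^T *m v.
rewrite !dotcvE mulr_sumr; apply: ler_sum => i _.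
rewrite mul_diag_mx !mxE -mulrA -expr2 ler_wpM2r ?sqr_ge0 //.
exact/fc/(spectral_eigenvalue _ UU Mdec).
Qed.

Lemma dotcv_matfun_le (R : realType) n (f : R -> R) (M : 'M[R]_n) c v :
  M^T = M -> (forall a, spectrum M a -> f a <= c) ->
  dotcv v (matfun f M *m v) <= c * dotcv v v.
Proof.
move=> Ms fc.
(* This is the lower bound for [- f], written as a product so that
   [matfunM] applies. *)
have := @dotcv_matfun_ge _ _ (fun x => -1 * f x) M (- c) v Ms.
rewrite (matfunM (fun=> -1) f) // matfun_cst //.
rewrite mul_scalar_mx scaleN1r mulNmx dotcvNr mulNr lerN2; apply => a Ma.
by rewrite mulN1r lerN2 fc.
Qed.

(** An eigenvalue of [Q^T *m A *m Q] is a Rayleigh quotient of [A]. *)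
Lemma spectrum_compression (R : realType) d e (Q : 'M[R]_(d, e)) (A : 'M[R]_d)
    lo hi a :
  Q^T *m Q = 1%:M -> A^T = A ->
  (forall x, spectrum A x -> lo <= x <= hi) ->
  spectrum (Q^T *m A *m Q) a -> lo <= a <= hi.
Proof.
move=> QQ As Alh /eigenvalueP [v vT v0]; pose x := v^T.
have Ts : (Q^T *m A *m Q)^T = Q^T *m A *m Q.
  by rewrite !trmx_mul trmxK As mulmxA.
have Tx : (Q^T *m A *m Q) *m x = a *: x.
  by rewrite /x -[in LHS]Ts -trmx_mul vT linearZ.
have xx : 0 < dotcv x x.
  rewrite lt_def dotcv_ge0 dotcv_eq0 andbT; apply: contra v0 => /eqP x0.
  by rewrite -(trmxK v) -/x x0 trmx0.
have Rayleigh : dotcv (Q *m x) (matfun id A *m (Q *m x)) = a * dotcv x x.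
  by rewrite matfun_id // dotcv_mulmxl !mulmxA Tx dotcvZr.
have QxQx : dotcv (Q *m x) (Q *m x) = dotcv x x.
  by rewrite -!norm2_sqr norm2_isometry.
apply/andP; split; rewrite -(ler_pM2r xx) -Rayleigh -QxQx.
  by apply: dotcv_matfun_ge => // y /Alh /andP[].
by apply: dotcv_matfun_le => // y /Alh /andP[].
Qed.

(** * Gram--Schmidt orthonormalization *)

Definition orthonormal (R : realType) d (qs : seq 'cV[R]_d) : bool :=
  all (fun q => dotcv q q == 1) qs && pairwise (fun u v => dotcv u v == 0) qs.

Definition colsmx (R : realType) d (qs : seq 'cV[R]_d) : 'M[R]_(d, size qs) :=
  \matrix_(i, j) qs`_j i 0.

Lemma col_colsmx (R : realType) d (qs : seq 'cV[R]_d) j :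
  col j (colsmx qs) = qs`_j.
Proof. by apply/matrixP => i l; rewrite !ord1 !mxE. Qed.

Lemma trmx_colsmx_mul (R : realType) d (qs : seq 'cV[R]_d) v i :
  ((colsmx qs)^T *m v) i 0 = dotcv qs`_i v.
Proof.
by rewrite dotcvE mxE; apply: eq_bigr => j _; rewrite !mxE.
Qed.

Lemma colsmx_proj (R : realType) d (qs : seq 'cV[R]_d) v :
  colsmx qs *m ((colsmx qs)^T *m v) = \sum_(q <- qs) dotcv q v *: q.
Proof.
rewrite (big_nth 0) big_mkord; apply/matrixP => i l; rewrite !ord1 mxE summxE.
by apply: eq_bigr => j _; rewrite trmx_colsmx_mul !mxE mulrC.
Qed.

Lemma orthonormal_colsmx (R : realType) d (qs : seq 'cV[R]_d) :
  orthonormal qs -> (colsmx qs)^T *m colsmx qs = 1%:M.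
Proof.
move=> /andP[/all_nthP q1 /(pairwiseP 0) q0]; apply/matrixP => i j.
have -> : ((colsmx qs)^T *m colsmx qs) i j = dotcv qs`_i qs`_j.
  rewrite -trmx_colsmx_mul -col_colsmx !mxE.
  by apply: eq_bigr => l _; rewrite !mxE.
have q0' (l m : 'I_(size qs)) : (l < m)%N -> dotcv qs`_l qs`_m = 0.
  by move=> lm; apply/eqP/q0; rewrite ?inE.
rewrite mxE; case: (ltngtP i j) => [ij|ji|ij].
- by rewrite q0' // -val_eqE /= ltn_eqF.
- by rewrite dotcvC q0' // -val_eqE /= gtn_eqF.
- by rewrite (val_inj ij) eqxx; apply/eqP/q1.
Qed.

Lemma gram_schmidt_rcons (R : realType) d (vs : seq 'cV[R]_d) v :
  gram_schmidt (rcons vs v) = gram_schmidt_step (gram_schmidt vs) v.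
Proof. by rewrite /gram_schmidt foldl_rcons. Qed.

Lemma orthonormal_residual (R : realType) d (qs : seq 'cV[R]_d) v q :
  orthonormal qs -> q \in qs ->
  dotcv q (v - \sum_(q <- qs) dotcv q v *: q) = 0.
Proof.
move=> /orthonormal_colsmx qs1 /(nthP 0) [i ltis <-].
rewrite -colsmx_proj -(trmx_colsmx_mul _ (Ordinal ltis)).
by rewrite mulmxBr (mulmxA (colsmx qs)^T) qs1 mul1mx subrr mxE.
Qed.

Lemma gram_schmidt_orthonormal (R : realType) d (vs : seq 'cV[R]_d) :
  orthonormal (gram_schmidt vs).
Proof.
elim/last_ind: vs => [//|vs v IH]; rewrite gram_schmidt_rcons.
rewrite /gram_schmidt_step; case: ifP => [//|/negbT w0].
have wq := orthonormal_residual v IH.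
set w := v - _ in w0 wq *; move: w w0 wq => w w0 wq.
case/andP: IH => q1 q0; rewrite /orthonormal all_rcons pairwise_rcons q1 q0.
rewrite !andbT; apply/andP; split.
  rewrite dotcvZr dotcvZl -norm2_sqr; apply/eqP.
  by field; rewrite norm2_eq0.
by apply/allP => q qqs; rewrite dotcvZr wq // mulr0.
Qed.

(** A vector already in the span has coefficient zero on each later [q], and a
    new vector is its residual plus the part subtracted from it. *)
Lemma gram_schmidt_proj (R : realType) d (vs : seq 'cV[R]_d) v :
  v \in vs -> \sum_(q <- gram_schmidt vs) dotcv q v *: q = v.
Proof.
elim/last_ind: vs v => [//|vs v IH] x; rewrite mem_rcons inE gram_schmidt_rcons.
rewrite /gram_schmidt_step; case: ifP => [|/negbT w0].
  by rewrite subr_eq0 => /eqP vE /orP[/eqP -> //|/IH].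
have wq := orthonormal_residual v (gram_schmidt_orthonormal vs).
have vE : v = (v - \sum_(q <- gram_schmidt vs) dotcv q v *: q) +
  \sum_(q <- gram_schmidt vs) dotcv q v *: q by rewrite subrK.
set w := v - _ in w0 wq vE *; move: w w0 wq vE => w w0 wq vE.
have wspan (c : 'cV[R]_d -> R) :
    dotcv w (\sum_(q <- gram_schmidt vs) c q *: q) = 0.
  rewrite dotcv_sumr big_seq big1 // => q qgs.
  by rewrite dotcvZr dotcvC wq // mulr0.
have wv : dotcv w v = norm2 w ^+ 2.
  by rewrite [in LHS]vE dotcvDr wspan addr0 norm2_sqr.
rewrite -cats1 big_cat big_seq1 /= => /orP[/eqP ->|/IH xE].
  rewrite dotcvZl wv scalerA.
  rewrite (_ : _ * _ = 1) ?scale1r; first by rewrite addrC -vE.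
  by field; rewrite norm2_eq0.
by rewrite dotcvZl -{2}xE wspan mulr0 scale0r addr0.
Qed.

(** A step only forms linear combinations. Applied to a Krylov sequence, this
    gives that every column of [lanczos_Q] is a polynomial in [A] applied to
    [b]. *)
Lemma gram_schmidt_closed (R : realType) d (S : 'cV[R]_d -> Prop)
    (vs : seq 'cV[R]_d) :
  S 0 -> (forall a u v, S u -> S v -> S (a *: u + v)) ->
  (forall v, v \in vs -> S v) ->
  forall q, q \in gram_schmidt vs -> S q.
Proof.
move=> S0 Slin; elim/last_ind: vs => [//|vs v IH] vsS q.
have {}IH : forall q, q \in gram_schmidt vs -> S q.
  by apply: IH => u uvs; apply: vsS; rewrite mem_rcons inE uvs orbT.
rewrite gram_schmidt_rcons /gram_schmidt_step; case: ifP => _; first exact: IH.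
rewrite mem_rcons inE => /orP[/eqP ->|]; last exact: IH.
have sumS : S (\sum_(q <- gram_schmidt vs) dotcv q v *: q).
  by rewrite big_seq; apply: (big_rec S) => // u x /IH uS xS; apply: (Slin).
rewrite -[_ *: _]addr0; apply: (Slin) => //.
rewrite -scaleN1r addrC; apply: (Slin) => //.
by apply: vsS; rewrite mem_rcons mem_head.
Qed.

(** * Krylov spaces *)

Lemma lanczos_Q_orthonormal (R : realType) d k (A : 'M[R]_d) b :
  (lanczos_Q k A b)^T *m lanczos_Q k A b = 1%:M.
Proof. exact/orthonormal_colsmx/gram_schmidt_orthonormal. Qed.

Lemma lanczos_T_sym (R : realType) d k (A : 'M[R]_d) b :
  A^T = A -> (lanczos_T k A b)^T = lanczos_T k A b.
Proof. by move=> As; rewrite /lanczos_T !trmx_mul trmxK As mulmxA. Qed.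

Lemma lanczos_Q_proj_iter (R : realType) d k (A : 'M[R]_d) b i :
  (i < k)%N -> let Q := lanczos_Q k A b in
  Q *m (Q^T *m iter i (mulmx A) b) = iter i (mulmx A) b.
Proof.
move=> ltik; apply: etrans (colsmx_proj _ _) _; apply: gram_schmidt_proj.
by apply/mapP; exists i; rewrite ?mem_iota.
Qed.

Lemma lanczos_Q_proj (R : realType) d k (A : 'M[R]_d) b (s : {poly R}) :
  A^T = A -> (size s <= k)%N -> let Q := lanczos_Q k A b in
  let v := matfun (fun x => s.[x]) A *m b in Q *m (Q^T *m v) = v.
Proof.
move=> As sk Q v; rewrite /v matfun_horner // !mulmx_sumr.
apply: eq_bigr => i _; rewrite -!scalemxAr lanczos_Q_proj_iter //.
exact: leq_trans (ltn_ord i) sk.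
Qed.

(** The compression [T] acts on the coordinates of [b] as [A] acts on [b], as
    long as the powers of [A] applied to [b] stay inside the Krylov space. *)
Lemma lanczos_T_horner (R : realType) d k (A : 'M[R]_d) b (s : {poly R}) :
  A^T = A -> (size s <= k)%N -> let Q := lanczos_Q k A b in
  Q^T *m (matfun (fun x => s.[x]) A *m b) =
  matfun (fun x => s.[x]) (lanczos_T k A b) *m (Q^T *m b).
Proof.
move=> As sk Q; rewrite !matfun_horner ?lanczos_T_sym // mulmx_sumr.
apply: eq_bigr => i _; rewrite -scalemxAr; congr (_ *: _).
have := leq_trans (ltn_ord i) sk; elim: (val i) => [//|l IH] ltlk.
rewrite !iterS -IH 1?ltnW // /lanczos_T -!mulmxA.
by rewrite lanczos_Q_proj_iter // ltnW.
Qed.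

Lemma lanczos_Q_range (R : realType) d k (A : 'M[R]_d) b y :
  A^T = A ->
  exists2 s : {poly R}, (size s <= k)%N &
    lanczos_Q k A b *m y = matfun (fun x => s.[x]) A *m b.
Proof.
move=> As.
pose S v := exists2 s : {poly R}, (size s <= k)%N &
  v = matfun (fun x => s.[x]) A *m b.
have S0 : S 0.
  by exists 0; rewrite ?size_poly0 // matfun_horner // size_poly0 big_ord0.
have Slin a u v : S u -> S v -> S (a *: u + v).
  move=> [s sk ->] [t tk ->]; exists (a *: s + t).
    apply: leq_trans (size_polyD _ _) _; rewrite geq_max tk andbT.
    exact: leq_trans (size_scale_leq _ _) sk.
  rewrite scalemxAl -mulmxDl -mul_scalar_mx -(matfun_cst a As).
  rewrite -matfunM // -matfunD //; congr (_ *m _); apply: eq_matfun => // x _.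
  by rewrite hornerD hornerZ.
have Skry v : v \in krylov_seq k A b -> S v.
  move=> vk; case: (mapP vk) => i; rewrite mem_iota /= => ik ->.
  exists 'X^i; first by rewrite size_polyXn.
  rewrite matfun_horner // size_polyXn (bigD1 ord_max) //= coefXn eqxx scale1r.
  rewrite big1 ?addr0 // => j; rewrite -val_eqE coefXn => /negPf ->.
  by rewrite scale0r.
have Sq := gram_schmidt_closed S0 Slin Skry.
have -> : lanczos_Q k A b *m y = \sum_j y j 0 *: (lanczos_basis k A b)`_j.
  apply/matrixP => i l; rewrite !ord1 mxE summxE.
  by apply: eq_bigr => j _; rewrite !mxE mulrC.
by apply: (big_rec S) => // j v _ Sv; apply: (Slin) => //; apply/Sq/mem_nth.
Qed.

(** The minimizer comes from the orthogonal projection of [v] on the Krylov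
    space, which is a polynomial in [A] applied to [b]. *)
Lemma krylov_best_approx (R : realType) d k (A : 'M[R]_d) b v :
  A^T = A ->
  exists e, is_minimum
    [set norm2 (v - matfun (fun x => s.[x]) A *m b)
    | s in [set s : {poly R} | (size s <= k)%N]] e.
Proof.
move=> As; pose Q := lanczos_Q k A b.
exists (norm2 (v - Q *m (Q^T *m v))); split => /=.
  have [s sk ->] := lanczos_Q_range ((lanczos_Q k A b)^T *m v) As.
  by exists s.
move=> _ [s sk <-]; rewrite -(lanczos_Q_proj b As sk).
exact/norm2_proj_le/lanczos_Q_orthonormal.
Qed.

(** * The error of a single shift *)

(** For [z] outside [[lmin, lmax]], these are the smallest and the largest value
    of [`|x - z|] over that interval. *)
Definition shift_lo (R : realType) (lmin lmax z : R) : R :=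
  Num.min `|lmin - z| `|lmax - z|.
Definition shift_hi (R : realType) (lmin lmax z : R) : R :=
  Num.max `|lmin - z| `|lmax - z|.

(** The sign of [x - z] is constant on the interval; multiplying by it treats
    the shifts on the two sides of the interval at once. *)
Lemma shift_sign (R : realType) (lmin lmax z : R) :
  lmin <= lmax -> ~~ (lmin <= z <= lmax) ->
  exists2 e : R, e = 1 \/ e = -1 &
    forall x, lmin <= x <= lmax -> `|x - z| = e * (x - z).
Proof.
move=> ll; rewrite negb_and -!ltNge => /orP[zl|lz].
  exists 1 => [|x /andP[lx _]]; first by left.
  by rewrite mul1r ger0_norm // subr_ge0 (le_trans (ltW zl)).
exists (-1) => [|x /andP[_ xl]]; first by right.
by rewrite mulN1r ler0_norm // subr_le0 (le_trans xl) // ltW.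
Qed.

Lemma shift_bounds (R : realType) (lmin lmax z x : R) :
  ~~ (lmin <= z <= lmax) -> lmin <= x <= lmax ->
  shift_lo lmin lmax z <= `|x - z| <= shift_hi lmin lmax z.
Proof.
move=> zout lxl; have /andP[lx xl] := lxl; have ll := le_trans lx xl.
have [e e1 eE] := shift_sign ll zout.
rewrite /shift_lo /shift_hi !eE ?lexx ?ll // ge_min le_max.
by case: e1 => ->; apply/andP; split; apply/orP;
  [left | right | right | left]; lra.
Qed.

Lemma shift_lo_gt0 (R : realType) (lmin lmax z : R) :
  lmin <= lmax -> ~~ (lmin <= z <= lmax) -> 0 < shift_lo lmin lmax z.
Proof.
move=> ll zout; rewrite lt_min !normr_gt0 !subr_eq0.
by apply/andP; split; apply: contraNneq zout => <-; rewrite lexx ll.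
Qed.

Lemma shift_lo_le_hi (R : realType) (lmin lmax z : R) :
  shift_lo lmin lmax z <= shift_hi lmin lmax z.
Proof. by rewrite /shift_lo /shift_hi ge_min !le_max !lexx. Qed.

(** Absolute values erase the sign that distinguishes the two branches of
    [shifted]. *)
Lemma spectrum_shifted (R : realType) d (A : 'M[R]_d) lmin z a :
  [set `|x| | x in spectrum (shifted A lmin z)] a <->
  [set `|x - z| | x in spectrum A] a.
Proof.
have shiftE x : spectrum (A - z%:M) x <-> spectrum A (x + z).
  split=> /eigenvalueP [v vA v0]; apply/eigenvalueP; exists v => //.
    by rewrite scalerDl -vA mulmxBr mul_mx_scalar subrK.
  by rewrite mulmxBr mul_mx_scalar vA scalerDl addrK.
have negE (M : 'M[R]_d) x : spectrum (- M) x <-> spectrum M (- x).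
  split=> /eigenvalueP [v vA v0]; apply/eigenvalueP; exists v => //.
    by rewrite scaleNr -vA mulmxN opprK.
  by rewrite mulmxN vA scaleNr opprK.
rewrite /shifted; case: ifP => _; split=> -[x] /=.
- by move=> /shiftE xA <-; exists (x + z) => //; rewrite addrK.
- by move=> xA <-; exists (x - z) => //; apply/shiftE; rewrite subrK.
- move=> /negE /shiftE xA <-; exists (- x + z) => //.
  by rewrite addrK normrN.
- move=> xA <-; exists (- (x - z)); last by rewrite normrN.
  by apply/negE/shiftE; rewrite opprK subrK.
Qed.

(** [x - z] does not vanish on the interval and is monotone in [x], so its
    absolute value is extremal at the endpoints, which are eigenvalues. *)
Lemma cond_shifted (R : realType) d (A : 'M[R]_d) lmin lmax z :
  is_minimum (spectrum A) lmin -> is_maximum (spectrum A) lmax ->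
  ~~ (lmin <= z <= lmax) ->
  cond (shifted A lmin z) = shift_hi lmin lmax z / shift_lo lmin lmax z.
Proof.
move=> [minA minP] [maxA maxP] zout.
have bnd x : spectrum A x ->
    shift_lo lmin lmax z <= `|x - z| <= shift_hi lmin lmax z.
  by move=> xA; apply: shift_bounds => //; rewrite minP // maxP.
rewrite /cond (_ : [set `|x| | x in _] = [set `|x - z| | x in spectrum A]).
  set E := [set _ | _ in _].
  have Emin : E `|lmin - z| by exists lmin.
  have Emax : E `|lmax - z| by exists lmax.
  have Elo : E (shift_lo lmin lmax z) by rewrite /shift_lo; case: ltP.
  have Ehi : E (shift_hi lmin lmax z) by rewrite /shift_hi; case: ltP.
  have lbE : lbound E (shift_lo lmin lmax z) by move=> _ [x /bnd /andP[? _] <-].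
  have ubE : ubound E (shift_hi lmin lmax z) by move=> _ [x /bnd /andP[_ ?] <-].
  congr (_ / _); apply/eqP; rewrite eq_le.
    apply/andP; split; first by apply: ge_sup => //; exists `|lmin - z|.
    by apply: ub_le_sup => //; exists (shift_hi lmin lmax z).
  apply/andP; split; last by apply: lb_le_inf => //; exists `|lmin - z|.
  by apply: ge_inf => //; exists (shift_lo lmin lmax z).
by apply/funext => a; apply/propext/spectrum_shifted.
Qed.

(** With [M := A - z%:M] and [Y := Q *m (Q^T *m M *m Q)^-1 *m Q^T], the operator
    [1 - Y *m M] vanishes on the range of [Q], which is why [w] may be
    subtracted. Up to the sign [e] of its eigenvalues, [M] is positive definite,
    and [1 - Y *m M] is an orthogonal projection for the inner product of
    [e *: M]. It does not increase the norm of that inner product, whose square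
    lies between [shift_lo] and [shift_hi] times the squared Euclidean norm. *)
Lemma galerkin_error (R : realType) d m (A : 'M[R]_d) (Q : 'M[R]_(d, m))
    lmin lmax z v w :
  A^T = A -> Q^T *m Q = 1%:M -> lmin <= lmax ->
  (forall a, spectrum A a -> lmin <= a <= lmax) -> ~~ (lmin <= z <= lmax) ->
  Q *m (Q^T *m w) = w ->
  norm2 (v - Q *m (matfun (fun x => (x - z)^-1) (Q^T *m A *m Q) *m
                   (Q^T *m ((A - z%:M) *m v)))) <=
  shift_hi lmin lmax z / shift_lo lmin lmax z * norm2 (v - w).
Proof.
move=> As QQ ll Alh zout Qw; set T := Q^T *m A *m Q.
have Ts : T^T = T by rewrite !trmx_mul trmxK As mulmxA.
have Tlh a : spectrum T a -> lmin <= a <= lmax by apply: spectrum_compression.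
have zN0 a : spectrum T a -> a - z != 0.
  by move=> /Tlh; apply: contraTN; rewrite subr_eq0 => /eqP ->.
set G := matfun _ T; set M := A - z%:M.
have QMQ : Q^T *m M *m Q = T - z%:M.
  rewrite /M mulmxBr mulmxBl mul_mx_scalar -scalemxAl QQ.
  by rewrite -mul_scalar_mx mulmx1.
have GT : G *m (T - z%:M) = 1%:M.
  rewrite -(matfun_shift z Ts) -matfunM // -(matfun_cst 1 Ts).
  by apply: eq_matfun => // a /zN0 a0; rewrite mulVf.
have TG : (T - z%:M) *m G = 1%:M by apply: mulmx1C.
set g := v - w; pose h := G *m (Q^T *m (M *m g)); pose p := g - Q *m h.
have -> : v - Q *m (G *m (Q^T *m (M *m v))) = p.
  have Yw : Q *m (G *m (Q^T *m (M *m w))) = w.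
    have -> : Q^T *m (M *m w) = (T - z%:M) *m (Q^T *m w).
      by rewrite -QMQ -!mulmxA Qw.
    by rewrite (mulmxA G) GT mul1mx.
  by rewrite /p /h /g !mulmxBr Yw opprB addrA subrK.
have pQ : Q^T *m (M *m p) = 0.
  have QMQh : Q^T *m (M *m (Q *m h)) = Q^T *m (M *m g).
    rewrite (mulmxA M Q h) (mulmxA Q^T _ h) (mulmxA Q^T M Q) QMQ.
    by rewrite /h (mulmxA _ G) TG mul1mx.
  by rewrite /p (mulmxBr M g) (mulmxBr Q^T (M *m g)) QMQh subrr.
have gE : g = p + Q *m h by rewrite /p subrK.
clearbody p h g.
have lo0 := shift_lo_gt0 ll zout; have lohi := shift_lo_le_hi lmin lmax z.
have [e _ eE] := shift_sign ll zout.
pose N := e *: M.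
have NE : N = matfun (fun x => e * (x - z)) A.
  by rewrite (matfunM (fun=> e)) // matfun_cst // matfun_shift // mul_scalar_mx.
have Nlo x : shift_lo lmin lmax z * dotcv x x <= dotcv x (N *m x).
  rewrite NE; apply: dotcv_matfun_ge => // a /Alh la; rewrite -eE //.
  by case/andP: (shift_bounds zout la).
have Nhi x : dotcv x (N *m x) <= shift_hi lmin lmax z * dotcv x x.
  rewrite NE; apply: dotcv_matfun_le => // a /Alh la; rewrite -eE //.
  by case/andP: (shift_bounds zout la).
have NT : N^T = N.
  by rewrite /N /M linearZ /= linearB /= tr_scalar_mx As.
have hp : dotcv (Q *m h) (N *m p) = 0.
  by rewrite dotcv_mulmxl /N -scalemxAl -scalemxAr pQ scaler0 dotcv0.
have ph : dotcv p (N *m (Q *m h)) = 0.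
  by rewrite -NT -dotcv_mulmxl dotcvC.
have pg : shift_lo lmin lmax z * dotcv p p <= shift_hi lmin lmax z * dotcv g g.
  apply: le_trans (Nlo p) (le_trans _ (Nhi g)).
  rewrite [in leRHS]gE mulmxDr dotcvDr !dotcvDl ph hp addr0 add0r lerDl.
  by apply: le_trans (Nlo _); rewrite mulr_ge0 ?dotcv_ge0 // ltW.
have k1 : 1 <= shift_hi lmin lmax z / shift_lo lmin lmax z.
  by rewrite ler_pdivlMr // mul1r.
apply: norm2_le_sqr; first exact: le_trans ler01 k1.
(* Since [hi / lo] is at least 1, its square dominates the factor [hi / lo]
   obtained for the squared norms. *)
have : dotcv p p <= shift_hi lmin lmax z / shift_lo lmin lmax z * dotcv g g.
  by rewrite mulrAC ler_pdivlMr // mulrC.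
move=> /le_trans; apply; rewrite ler_wpM2r ?dotcv_ge0 // expr2.
by rewrite ler_peMl // (le_trans ler01 k1).
Qed.

(** * The error of a product of shifts *)

Lemma norm2_shift_le (R : realType) d (A : 'M[R]_d) lmin lmax z v :
  A^T = A -> (forall a, spectrum A a -> lmin <= a <= lmax) ->
  ~~ (lmin <= z <= lmax) ->
  norm2 ((A - z%:M) *m v) <= shift_hi lmin lmax z * norm2 v.
Proof.
move=> As Alh zout; rewrite -matfun_shift //; apply: norm2_matfun_le => //.
  by rewrite /shift_hi le_max normr_ge0.
by move=> a /Alh la; case/andP: (shift_bounds zout la).
Qed.

(** The eigenvalues of the compression stay in [[lmin, lmax]], so its inverse
    after the shift is bounded as that of [A - z%:M] is. *)
Lemma norm2_galerkin_le (R : realType) d m (A : 'M[R]_d) (Q : 'M[R]_(d, m))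
    lmin lmax z v :
  A^T = A -> Q^T *m Q = 1%:M -> lmin <= lmax ->
  (forall a, spectrum A a -> lmin <= a <= lmax) -> ~~ (lmin <= z <= lmax) ->
  norm2 (Q *m (matfun (fun x => (x - z)^-1) (Q^T *m A *m Q) *m (Q^T *m v))) <=
  (shift_lo lmin lmax z)^-1 * norm2 v.
Proof.
move=> As QQ ll Alh zout; have lo0 := shift_lo_gt0 ll zout.
have lo0' : 0 <= (shift_lo lmin lmax z)^-1 by rewrite invr_ge0 ltW.
rewrite norm2_isometry //.
apply: le_trans (ler_wpM2l lo0' (bessel_inequality v QQ)).
apply: norm2_matfun_le => // [|a]; first by rewrite !trmx_mul trmxK As mulmxA.
move=> /(spectrum_compression QQ As Alh) la.
have /andP[loa _] := shift_bounds zout la.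
by rewrite normfV lef_pV2 // posrE (lt_le_trans lo0 loa).
Qed.

(** With [M i := A - z i] and [Y i := Q *m (Q^T *m M i *m Q)^-1 *m Q^T], the
    induction on the number of shifts rests on
    [x - Y 1 Y 2 .. M 2 M 1 x =
       (x - Y 1 M 1 x) + Y 1 (M 1 x - Y 2 .. M 2 (M 1 x))],
    where the last parenthesis is the same expression for the remaining shifts
    and the vector [M 1 x], which [M 1 s(A) b] approximates. Passing from [s] to
    [('X - z 1) * s] costs one degree, whence the bound on [size s]; passing
    from [x] to [M 1 x] and back through [Y 1] costs [hi / lo]. *)
Lemma lanczos_product_error (R : realType) d k (A : 'M[R]_d) (b : 'cV[R]_d)
    lmin lmax z zs x (s : {poly R}) :
  A^T = A -> lmin <= lmax ->
  (forall a, spectrum A a -> lmin <= a <= lmax) ->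
  (forall y, y \in z :: zs -> ~~ (lmin <= y <= lmax)) ->
  (size s + size zs <= k)%N ->
  let Q := lanczos_Q k A b in
  norm2 (x - Q *m (matfun (fun t => \prod_(y <- z :: zs) (t - y)^-1)
                          (lanczos_T k A b) *m
       (Q^T *m (matfun (fun t => \prod_(y <- z :: zs) (t - y)) A *m x)))) <=
  (size zs).+1%:R *
  (\prod_(y <- z :: zs) (shift_hi lmin lmax y / shift_lo lmin lmax y)) *
  norm2 (x - matfun (fun t => s.[t]) A *m b).
Proof.
move=> As ll Alh; cbv zeta.
set Q := lanczos_Q k A b; set T := lanczos_T k A b.
have QQ : Q^T *m Q = 1%:M := lanczos_Q_orthonormal k A b.
have Ts : T^T = T := lanczos_T_sym k b As.
elim: zs z x s => [|z' zs IH] z x s zout sk.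
  have sk' : (size s <= k)%N by rewrite addn0 in sk.
  rewrite big_seq1 mul1r.
  under [fun t => \prod_(y <- _) _^-1]funext do rewrite big_seq1.
  under [fun t => \prod_(y <- _) _]funext do rewrite big_seq1.
  rewrite matfun_shift //.
  by apply: galerkin_error => //; [apply/zout/mem_head | apply: lanczos_Q_proj].
have z_out : ~~ (lmin <= z <= lmax) by apply/zout/mem_head.
have lo0 := shift_lo_gt0 ll z_out; have lohi := shift_lo_le_hi lmin lmax z.
set M := A - z%:M; set G := matfun (fun t => (t - z)^-1) T.
set w := matfun (fun t => s.[t]) A *m b.
set F := matfun (fun t => \prod_(y <- z' :: zs) (t - y)^-1) T.
set N := matfun (fun t => \prod_(y <- z' :: zs) (t - y)) A.
have -> : matfun (fun t => \prod_(y <- [:: z, z' & zs]) (t - y)^-1) T = G *m F.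
  by rewrite -matfunM //; apply: eq_matfun => // a _; rewrite big_cons.
have -> : matfun (fun t => \prod_(y <- [:: z, z' & zs]) (t - y)) A = N *m M.
  rewrite /M -matfun_shift // -matfunM //; apply: eq_matfun => // a _.
  by rewrite big_cons mulrC.
set y := F *m (Q^T *m (N *m (M *m x))).
have -> : G *m F *m (Q^T *m (N *m M *m x)) = G *m y by rewrite /y !mulmxA.
have -> : x - Q *m (G *m y) =
    (x - Q *m (G *m (Q^T *m (M *m x)))) +
    Q *m (G *m (Q^T *m (M *m x - Q *m y))).
  rewrite (mulmxBr Q^T (M *m x)) (mulmxA Q^T Q y) QQ mul1mx.
  by rewrite (mulmxBr G) (mulmxBr Q (G *m _)) addrA subrK.
apply: le_trans (norm2D _ _) _.
have Mw : M *m w = matfun (fun t => (('X - z%:P) * s).[t]) A *m b.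
  rewrite /M -matfun_shift // mulmxA -matfunM //; congr (_ *m _).
  by apply: eq_matfun => // a _; rewrite hornerM hornerXsubC.
have first_le : norm2 (x - Q *m (G *m (Q^T *m (M *m x)))) <=
    shift_hi lmin lmax z / shift_lo lmin lmax z * norm2 (x - w).
  apply: galerkin_error => //; apply: lanczos_Q_proj => //.
  exact: leq_trans (leq_addr _ _) sk.
have tail_out u : u \in z' :: zs -> ~~ (lmin <= u <= lmax).
  by move=> uzs; apply: zout; rewrite inE uzs orbT.
have size_zs : (size (('X - z%:P)%R * s)%R + size zs <= k)%N.
  apply: leq_trans sk; rewrite /= addnS -addSn leq_add2r.
  by apply: leq_trans (size_polyMleq _ _) _; rewrite size_XsubC.
have tail_le := IH z' (M *m x) _ tail_out size_zs.
rewrite -Mw -mulmxBr -/F -/N -/y in tail_le.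
have rest_le := norm2_galerkin_le (M *m x - Q *m y) As QQ ll Alh z_out.
have Mxw_le := norm2_shift_le (x - w) As Alh z_out.
set kap := shift_hi lmin lmax z / shift_lo lmin lmax z in first_le *.
have kap_ge1 : 1 <= kap by rewrite /kap ler_pdivlMr // mul1r.
have kap_prod_ge1 (r : seq R) : (forall u, u \in r -> ~~ (lmin <= u <= lmax)) ->
    1 <= \prod_(u <- r) (shift_hi lmin lmax u / shift_lo lmin lmax u).
  move=> r_out; rewrite big_seq; apply: (big_ind (>= 1)) => //.
    by move=> c c' c1 c1'; rewrite -[1]mulr1 ler_pM.
  move=> u ur; rewrite ler_pdivlMr ?mul1r ?shift_lo_le_hi //.
  exact/shift_lo_gt0/r_out.
have P1 := kap_prod_ge1 _ tail_out.
rewrite big_cons -/kap; set P := \prod_(_ <- _) _ in P1 tail_le *.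
have {}rest_le : norm2 (Q *m (G *m (Q^T *m (M *m x - Q *m y)))) <=
    (size (z' :: zs))%:R * (kap * P) * norm2 (x - w).
  apply: le_trans rest_le _; rewrite ler_pdivrMl //.
  apply: le_trans tail_le _.
  have -> : shift_lo lmin lmax z *
      ((size (z' :: zs))%:R * (kap * P) * norm2 (x - w)) =
      (size (z' :: zs))%:R * P * (shift_hi lmin lmax z * norm2 (x - w)).
    by rewrite /kap; field; rewrite gt_eqF.
  by rewrite ler_wpM2l // mulr_ge0 // (le_trans ler01 P1).
apply: le_trans (lerD first_le rest_le) _.
rewrite [in leRHS]mulrSr !mulrDl mul1r addrC lerD2l.
rewrite ler_wpM2r ?norm2_ge0 // ler_peMr //.
exact: le_trans ler01 kap_ge1.
Qed.

(** * The error bound for rational functions *)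

Unset Implicit Arguments.

Theorem theorem4 (R : realType) (d : nat) (A : 'M[R]_d) (b : 'cV[R]_d)
    (lmin lmax : R) (p q k : nat) (n : {poly R}) (z : 'I_q -> R)
    (A_sym : A^T = A)
    (lmin_eig : is_minimum (spectrum A) lmin)
    (lmax_eig : is_maximum (spectrum A) lmax)
    (deg_n : (size n).-1 = p)
    (q_ge1 : (1 <= q)%N)
    (z_out : forall j, ~~ (lmin <= z j <= lmax))
    (k_gt : (maxn p (q - 1) < k)%N) :
  let r := ratfun n z in
  exists2 e : R,
    is_minimum [set norm2 (matfun r A *m b - matfun (fun x => s.[x]) A *m b)
               | s in [set s : {poly R} | (size s <= k - q + 1)%N]] e
    & norm2 (matfun r A *m b - lan k r A b)
      <= q%:R * (\prod_(j < q) cond (shifted A lmin (z j))) * e.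
Proof.
move=> r.
have [e e_min] := krylov_best_approx (k - q + 1) b (matfun r A *m b) A_sym.
exists e => //; have [[s /= sk <-] _] := e_min.
move: k_gt; rewrite gtn_max => /andP[pk qk].
have ll : lmin <= lmax by apply: lmax_eig.2; exact: lmin_eig.1.
have Alh a : spectrum A a -> lmin <= a <= lmax.
  by move=> Aa; rewrite lmin_eig.2 ?lmax_eig.2.
have QQ := lanczos_Q_orthonormal k A b.
have Ts := lanczos_T_sym k b A_sym.
set T := lanczos_T k A b in Ts *; set Q := lanczos_Q k A b in QQ *.
pose zs := [seq z j | j <- enum 'I_q].
have zs_prod (F : R -> R) : \prod_(y <- zs) F y = \prod_(j < q) F (z j).
  by rewrite /zs big_map big_enum.
have zs_out y : y \in zs -> ~~ (lmin <= y <= lmax).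
  by move=> /mapP [j _ ->].
have size_zs : size zs = q by rewrite size_map size_enum_ord.
have nA : matfun (fun t => \prod_(y <- zs) (t - y)) A *m (matfun r A *m b) =
    matfun (fun t => n.[t]) A *m b.
  rewrite mulmxA -matfunM //; congr (_ *m _); apply: eq_matfun => // a /Alh la.
  rewrite zs_prod /r /ratfun mulrC divfK //; apply/prodf_neq0 => j _.
  by rewrite subr_eq0; apply: contraNneq (z_out j) => <-.
have lanE : lan k r A b =
    Q *m (matfun (fun t => \prod_(y <- zs) (t - y)^-1) T *m
      (Q^T *m (matfun (fun t => n.[t]) A *m b))).
  rewrite lanczos_T_horner //; last by rewrite -deg_n in pk; case: size pk.
  rewrite -/T -/Q (mulmxA (matfun _ T) (matfun _ T)) -matfunM // /lan !mulmxA.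
  congr (_ *m _ *m _ *m _); apply: eq_matfun => // a _.
  by rewrite /r /ratfun zs_prod prodfV mulrC.
have condE y : y \in zs ->
    cond (shifted A lmin y) = shift_hi lmin lmax y / shift_lo lmin lmax y.
  by move=> /zs_out; apply: cond_shifted.
have -> : \prod_(j < q) cond (shifted A lmin (z j)) =
    \prod_(y <- zs) (shift_hi lmin lmax y / shift_lo lmin lmax y).
  by rewrite -(zs_prod (fun y => cond (shifted A lmin y))); apply: eq_big_seq.
rewrite lanE -nA -size_zs.
case: zs size_zs zs_out {zs_prod nA lanE condE} => [|y zs] size_zs zs_out.
  by rewrite -size_zs in q_ge1.
apply: lanczos_product_error => //.
by move: sk qk; rewrite -size_zs /=; lia.
Qed.
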